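(* Let $r\ge2$ and let $\operatorname{Ferm}(q)$, $\operatorname{Bos}(q)$, $\mathcal I$, $\mathcal I_q$ be as defined in the context. The identity $$\operatorname{Ferm}(q)\times\operatorname{Bos}(q)\equiv 1\pmod{\mathcal I_q}$$ holds if and only if $$\operatorname{Ferm}(1)\times\operatorname{Bos}(1)\equiv 1\pmod{\mathcal I}$$ holds.
   Context: Fix an integer $r\ge 2$ and the alphabet $\mathbb A=\{1,2,\dots,r\}$. A biword is a $2\times n$ matrix $\alpha=\binom{x_1\cdots x_n}{a_1\cdots a_n}$ ($n\ge 0$) with entries in $\mathbb A$, of length $\ell(\alpha)=n$, viewed as the word $\binom{x_1}{a_1}\cdots\binom{x_n}{a_n}$ in biletters; the product of biwords is concatenation, the empty biword is the unit $1$, and $\mathcal B$ is the set of all biwords. $\mathcal A=\mathbb Z\langle\langle\mathcal B\rangle\rangle$ and $\mathcal A_q=\mathbb Z[q,q^{-1}]\langle\langle\mathcal B\rangle\rangle$ are the algebras of all (possibly infinite) formal sums $E=\sum_{\alpha\in\mathcal B}c(\alpha)\alpha$ with coefficients in $\mathbb Z$, resp. $\mathbb Z[q,q^{-1}]$, with product $\times$ induced by concatenation. $E^{(n)}=\sum_{\ell(\alpha)=n}c(\alpha)\alpha$ (a finite sum) is the degree-$n$ homogeneous component. Relations. For $x>y$ in $\mathbb A$ put $$\left[{xy\atop ab}\right]=\binom{yx}{ba}+\binom{yx}{ab}-\binom{xy}{ba}\ (a>b),\quad \left[{xy\atop aa}\right]=\binom{yx}{aa}\ (\text{all } a),$$ $$\left[{xy\atop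 ab}\right]_q=\binom{yx}{ba}+q\binom{yx}{ab}-q^{-1}\binom{xy}{ba}\ (a>b),\quad \left[{xy\atop aa}\right]_q=q\binom{yx}{aa}\ (\text{all } a).$$ Ideals. $\mathcal I$ (resp. $\mathcal I_q$) denotes the two-sided ideal of $\mathcal A$ (resp. $\mathcal A_q$) generated by the elements $\binom{xy}{ab}-\left[{xy\atop ab}\right]$ (resp. $\binom{xy}{ab}-\left[{xy\atop ab}\right]_q$), $x>y$, $a\ge b$. This is understood degreewise: $E$ belongs to the ideal if and only if, for every $n\ge0$, $E^{(n)}$ belongs to the two-sided ideal generated by the same elements in the algebra $\mathbb Z\langle\mathcal B\rangle$ (resp. $\mathbb Z[q,q^{-1}]\langle\mathcal B\rangle$) of finite sums. For a word $w=w_1\cdots w_n$, $\operatorname{inv}w=\#\{(i,j):i<j,\ w_i>w_j\}$. Define in $\mathcal A_q$ $$\operatorname{Ferm}(q)=\sum_{J\subset\mathbb A}(-1)^{|J|}\sum_{\sigma\in\mathfrak S_J}(-q)^{-\operatorname{inv}\sigma}\binom{\sigma(i_1)\,\sigma(i_2)\cdots\sigma(i_l)}{i_1\,i_2\cdots i_l},\qquad \operatorname{Bos}(q)=\sum_w q^{\operatorname{inv}w}\binom{\overline w}{w},$$ where $J=\{i_1<i_2<\cdots<i_l\}$ runs over all subsets of $\mathbb A$ (including $\emptyset$), $\mathfrak S_J$ is the permutation group of $J$, $\operatorname{inv}\sigma=\operatorname{inv}(\sigma(i_1)\cdots\sigma(i_l))$, $w$ runs over all words on $\mathbb A$ (including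 the empty word), and $\overline w$ is the nondecreasing rearrangement of $w$. $\operatorname{Ferm}(1)$, $\operatorname{Bos}(1)\in\mathcal A$ are obtained by setting $q=1$. *)

(* Defs.v *)
From HB Require Import structures.
From mathcomp Require Import all_boot all_order all_algebra all_fingroup.
From mathcomp Require Import boolp.
From mathcomp.multinomials Require Import monalg.

Set Implicit Arguments.
Unset Strict Implicit.
Unset Printing Implicit Defensive.

Import GRing.Theory.

Local Open Scope ring_scope.

Local Notation "x %:F" := (@FracField.tofrac _ x) : ring_scope.

(* The ring Z[q, q^-1], as the subring of the fraction field of Z[q] made of   *)
(* the fractions p(q) / q^n.                                                   *)

Definition laurent_pred : pred {fraction {poly int}} := fun x =>
  `[< exists (p : {poly int}) (n : nat), x = p%:F / ('X%:F) ^+ n >].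

Lemma tofracX_neq0 : ('X : {poly int})%:F != 0 :> {fraction {poly int}}.
Proof. by rewrite tofrac_eq0 polyX_eq0. Qed.

Lemma laurent_subring_closed : subring_closed laurent_pred.
Proof.
have X0 n : ('X : {poly int})%:F ^+ n != 0 :> {fraction {poly int}}.
  by rewrite expf_neq0 // tofracX_neq0.
split=> [|x y /asboolP[p [m ->]] /asboolP[s [n ->]]
        |x y /asboolP[p [m ->]] /asboolP[s [n ->]]]; apply/asboolP.
- by exists 1, 0%N; rewrite tofrac1 expr0 divr1.
- exists (p * 'X^n - s * 'X^m), (m + n)%N.
  rewrite tofracB !tofracM !tofracXn exprD mulrBl.
  congr (_ - _); first by rewrite -mulf_div divff ?mulr1.
  by rewrite [_ ^+ m * _ ^+ n]mulrC -mulf_div divff ?mulr1.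
- by exists (p * s), (m + n)%N; rewrite tofracM exprD mulf_div.
Qed.

HB.instance Definition _ :=
  GRing.isSubringClosed.Build {fraction {poly int}} laurent_pred
    laurent_subring_closed.

Record laurent :=
  Laurent { laurent_val :> {fraction {poly int}}; _ : laurent_pred laurent_val }.

HB.instance Definition _ := [isSub for laurent_val].
HB.instance Definition _ := [Choice of laurent by <:].
HB.instance Definition _ := [SubChoice_isSubComNzRing of laurent by <:].

Definition laurent_unit : pred laurent := fun x =>
  (val x != 0) && laurent_pred (val x)^-1.

Definition laurent_inv (x : laurent) : laurent :=
  if laurent_unit x then insubd x (val x)^-1 else x.

Lemma laurent_mulVr : {in laurent_unit, left_inverse 1 laurent_inv *%R}.
Proof.
move=> x ux; rewrite /laurent_inv (ux : laurent_unit x).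
case/andP: (ux : laurent_unit x) => x0 xL; apply: val_inj.
by rewrite rmorphM rmorph1 /= insubdK // mulVf.
Qed.

Lemma laurent_unitP (x y : laurent) : y * x = 1 -> laurent_unit x.
Proof.
move=> /(congr1 val); rewrite rmorphM rmorph1 /= => yx1.
have x0 : val x != 0.
  by apply/eqP => x0; move/eqP: yx1; rewrite x0 mulr0 eq_sym oner_eq0.
apply/andP; split=> //.
by rewrite -[_^-1]mul1r -yx1 mulfK //; exact: (valP y).
Qed.

Lemma laurent_invr_out : {in [predC laurent_unit], laurent_inv =1 id}.
Proof. by move=> x /negPf ux; rewrite /laurent_inv [laurent_unit x]ux. Qed.

HB.instance Definition _ :=
  GRing.ComNzRing_hasMulInverse.Build laurent
    laurent_mulVr laurent_unitP laurent_invr_out.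

Lemma laurent_predX : laurent_pred ('X%:F).
Proof. by apply/asboolP; exists 'X, 0%N; rewrite expr0 divr1. Qed.

Definition qvar : laurent := Laurent laurent_predX.

Lemma qvar_unit : qvar \is a GRing.unit.
Proof.
apply/andP; split; first exact: tofracX_neq0.
by apply/asboolP; exists 1, 1%N; rewrite tofrac1 expr1 mul1r.
Qed.

(* The alphabet {1, ..., r} is 'I_r, with its usual order.  A biletter is a    *)
(* pair (top letter, bottom letter); biwords form the free monoid on biletters.*)

Notation biletter r := ('I_r * 'I_r)%type.
Notation biword r := {fmonom biletter r}.

(* The biword with top word x and bottom word a (of the same length). *)
Definition biw (r : nat) (x a : seq 'I_r) : biword r := FMonom (zip x a).

(* Formal sums are given by their coefficients. *)
Definition series (r : nat) (R : Type) := biword r -> R.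

Section Series.
Variables (r : nat) (R : comNzRingType).
Implicit Types E F : series r R.

Definition sone : series r R := fun u => (u == FMonom [::])%:R.

Definition ssub E F : series r R := fun u => E u - F u.

(* The coefficient of u sums over all factorizations u = u1 u2. *)
Definition smul E F : series r R := fun u =>
  \sum_(i < (size u).+1) E (FMonom (take i u)) * F (FMonom (drop i u)).

Definition hcomp (n : nat) E : {malg R[biword r]} :=
  \sum_(t : n.-tuple (biletter r)) << E (FMonom t) *g FMonom t >>.

End Series.

Definition two_sided_ideal (A : nzRingType) (G : A -> Prop) (z : A) : Prop :=
  exists (n : nat) (a g b : 'I_n -> A),
    (forall i, G (g i)) /\ z = \sum_(i < n) a i * g i * b i.

(* For y < x and b <= a, [bracket x y a b] is the right-hand side of the       *)
(* straightening relation for (x y / a b).  Membership of an infinite sum in   *)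
(* the ideal is degreewise: every homogeneous component lies in the two-sided  *)
(* ideal of the free algebra of finite sums.                                   *)

Section Ideals.
Variable r : nat.
Implicit Types x y a b : 'I_r.

Definition bracket x y a b : {malg int[biword r]} :=
  if a == b then << biw [:: y; x] [:: a; a] >>
  else << biw [:: y; x] [:: b; a] >> + << biw [:: y; x] [:: a; b] >>
       - << biw [:: x; y] [:: b; a] >>.

Definition bracketq x y a b : {malg laurent[biword r]} :=
  if a == b then << qvar *g biw [:: y; x] [:: a; a] >>
  else << biw [:: y; x] [:: b; a] >> + << qvar *g biw [:: y; x] [:: a; b] >>
       - << qvar^-1 *g biw [:: x; y] [:: b; a] >>.

Definition gens (g : {malg int[biword r]}) : Prop :=
  exists x y a b : 'I_r, [/\ (y < x)%N, (b <= a)%N &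
    g = << biw [:: x; y] [:: a; b] >> - bracket x y a b].

Definition gensq (g : {malg laurent[biword r]}) : Prop :=
  exists x y a b : 'I_r, [/\ (y < x)%N, (b <= a)%N &
    g = << biw [:: x; y] [:: a; b] >> - bracketq x y a b].

Definition ideal1 (E : series r int) : Prop :=
  forall n : nat, two_sided_ideal gens (hcomp n E).

Definition idealq (E : series r laurent) : Prop :=
  forall n : nat, two_sided_ideal gensq (hcomp n E).

Definition eqmodI (E F : series r int) : Prop := ideal1 (ssub E F).

Definition eqmodIq (E F : series r laurent) : Prop := idealq (ssub E F).

End Ideals.

Definition winv (r : nat) (w : seq 'I_r) : nat :=
  #|[set p : 'I_(size w) * 'I_(size w) |
     (p.1 < p.2)%N && (tnth (in_tuple w) p.2 < tnth (in_tuple w) p.1)%N]|.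

Section FermBos.
Variables (r : nat) (R : comUnitRingType) (q : R).

(* [enum J] lists J increasingly; permutations of J are the permutations of    *)
(* the alphabet fixing every letter outside J.                                 *)
Definition Ferm : series r R := fun u =>
  \sum_(J : {set 'I_r}) (-1) ^+ #|J| *
    \sum_(s : {perm 'I_r} | perm_on J s)
      (- q) ^- winv (map s (enum J)) * (u == biw (map s (enum J)) (enum J))%:R.

(* Only the words w of the same length as u contribute to the coefficient of u.*)
Definition Bos : series r R := fun u =>
  \sum_(w : (size u).-tuple 'I_r)
    q ^+ winv w *
    (u == biw (sort (fun i j : 'I_r => (i <= j)%N) w) w)%:R.

End FermBos.

Arguments sone r R : clear implicits.
Arguments Ferm r {R} q.
Arguments Bos r {R} q.

(* Main.v *)
(* Give the biword u with top word x and bottom word a the weight              *)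
(* t^(inv a - inv x).  In a product u g v with g a relation, the inversions    *)
(* between u, g and v depend only on the letters involved, so rescaling every  *)
(* biword by its weight, after a ring morphism f, turns each relation with     *)
(* parameter p into a scalar multiple of the one with parameter t f(p).  On    *)
(* biwords whose top word rearranges the bottom word the weight is             *)
(* multiplicative, whence Ferm Bos - 1 at p is sent to Ferm Bos - 1 at t f(p). *)
(* One implication is the case of evaluation at q = 1 with t = 1, the other    *)
(* the case p = 1, t = q.                                                      *)

From HB Require Import structures.
Require Import Defs.
From mathcomp Require Import all_boot all_order all_algebra all_fingroup.
From mathcomp Require Import zify boolp finmap.
From mathcomp.multinomials Require Import monalg.

Set Implicit Arguments.
Unset Strict Implicit.
Unset Printing Implicit Defensive.

Import GRing.Theory.

Local Open Scope ring_scope.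

(** The rescaling map [twist] is not multiplicative, yet it carries the ideal at p into the ideal at
    [t * f p]. The monomials of one relation share the contents of both rows, so a context (u, v)
    multiplies all their weights by one common factor ([biweight_context]). What remains is a
    computation on two-letter biwords ([twist_relation]), and [twist_two_sided_ideal] extends it to
    the whole ideal. The coefficients of Ferm and Bos rescale exactly because Ferm has increasing
    bottom rows and Bos sorted top rows. Both vanish off circuits, where the weight is
    multiplicative, so the product rescales as well ([biweight_MacMahon]). [MacMahon_transport]
    combines these facts and is applied once for each implication. *)

(** * Inversions of words and of concatenations *)

Section Inversions.
Variable r : nat.
Implicit Types (x : 'I_r) (u v w s : seq 'I_r).

Fixpoint inv_seq w : nat :=
  if w is x :: w' then (count (fun y : 'I_r => y < x)%N w' + inv_seq w')%N
  else 0%N.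

Definition inv_cross u v : nat :=
  (\sum_(x <- u) count (fun y : 'I_r => (y < x)%N) v)%N.

Lemma inv_seq_sum x0 w :
  (\sum_(i < size w) \sum_(j < size w)
     ((i < j) && (nth x0 w j < nth x0 w i)))%N = inv_seq w.
Proof.
elim: w => [|x w IHw] /=; first by rewrite big_ord0.
(* Row i = 0 gives the inversions caused by the head; column j = 0 contributes nothing. *)
rewrite big_ord_recl big_ord_recl /= add0n; congr addn; last first.
  rewrite -IHw; apply: eq_bigr => i _.
  by rewrite big_ord_recl /= add0n.
rewrite -sum1_count (big_nth x0) big_mkord [RHS]big_mkcond /=.
by apply: eq_bigr => i _; case: ltnP.
Qed.

Lemma winvE w : winv w = inv_seq w.
Proof.
(* The empty word is set apart because [inv_seq_sum] takes a letter as default value for [nth]. *)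
case: w => [|x0 w0].
  by rewrite /winv; apply/eqP; rewrite cards_eq0; apply/eqP/setP => -[[]].
move: (x0 :: w0) => w; rewrite -(inv_seq_sum x0) /winv cardE.
rewrite -sum1_size big_enum /= pair_big /= big_mkcond /=.
by apply: eq_bigr => -[i j] _ /=; rewrite inE /= !(tnth_nth x0) /=; case: ifP.
Qed.

Lemma inv_seq_cat u v :
  inv_seq (u ++ v) = (inv_seq u + inv_seq v + inv_cross u v)%N.
Proof.
rewrite /inv_cross; elim: u => [|x u IHu] /=; first by rewrite big_nil addn0.
rewrite big_cons IHu count_cat; lia.
Qed.

(** Inversions across two blocks depend only on the multisets of letters; both key properties of the
    weight rest on this. *)
Lemma inv_cross_perm u u' v v' :
  perm_eq u u' -> perm_eq v v' -> inv_cross u v = inv_cross u' v'.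
Proof.
move=> puu pvv; rewrite /inv_cross (perm_big _ puu) /=.
by apply: eq_bigr => x _; exact: (seq.permP pvv).
Qed.

Lemma inv_seq_sorted w :
  sorted (fun i j : 'I_r => (i <= j)%N) w -> inv_seq w = 0%N.
Proof.
elim: w => [//|x w IHw] /= p; rewrite IHw ?(path_sorted p) // addn0.
apply/eqP; rewrite -leqn0 leqNgt -has_count -all_predC.
have /allP xw : all (fun j : 'I_r => (x <= j)%N) w.
  by apply: order_path_min p => i j k; apply: leq_trans.
by apply/allP => y /xw /=; rewrite -leqNgt.
Qed.

Lemma inv_seq_sort w : inv_seq (sort (fun i j : 'I_r => (i <= j)%N) w) = 0%N.
Proof. by apply/inv_seq_sorted/sort_sorted => i j; apply: leq_total. Qed.

Lemma inv_seq_enum (J : {set 'I_r}) : inv_seq (enum J) = 0%N.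
Proof.
apply: inv_seq_sorted; rewrite /enum_mem; apply: sorted_filter.
  by move=> i j k; apply: leq_trans.
by have := iota_sorted 0 r; rewrite -val_enum_ord sorted_map enumT.
Qed.

End Inversions.

(** * The weight of a biword, on circuits and in context *)

Lemma unzip1_cat (T U : Type) (s1 s2 : seq (T * U)) :
  unzip1 (s1 ++ s2) = unzip1 s1 ++ unzip1 s2.
Proof. exact: map_cat. Qed.

Lemma unzip2_cat (T U : Type) (s1 s2 : seq (T * U)) :
  unzip2 (s1 ++ s2) = unzip2 s1 ++ unzip2 s2.
Proof. exact: map_cat. Qed.

Section BiwordWeight.
Variables (r : nat) (S : comUnitRingType) (t : S).
Hypothesis t_unit : t \is a GRing.unit.
Implicit Types (u v k : seq (biletter r)).

Definition biweight u : S :=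
  t ^+ inv_seq (unzip2 u) / t ^+ inv_seq (unzip1 u).

Definition circuit u := perm_eq (unzip1 u) (unzip2 u).

Lemma biweight_nil : biweight [::] = 1.
Proof. by rewrite /biweight /= divr1. Qed.

(** The cross inversions of the top rows equal those of the bottom rows, hence cancel in the
    quotient. *)
Lemma biweight_circuit_cat u v :
  circuit u -> circuit v -> biweight (u ++ v) = biweight u * biweight v.
Proof.
move=> cu cv; rewrite /biweight !(unzip1_cat, unzip2_cat) !inv_seq_cat.
rewrite (inv_cross_perm cu cv).
rewrite !exprD invrM ?unitrM ?unitrX // [LHS]mulrA mulrK ?unitrX //.
by rewrite invrM ?unitrX // [RHS]mulrACA [X in _ = _ * X]mulrC.
Qed.

Lemma biweight_pair (x y a b : 'I_r) :
  biweight (biw [:: x; y] [:: a; b]) = t ^+ (b < a)%N / t ^+ (y < x)%N.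
Proof. by rewrite /biweight /= !addn0. Qed.

Lemma inv_seq_context (u v l : seq 'I_r) :
  exists m, forall k : seq 'I_r,
  perm_eq k l -> inv_seq (u ++ k ++ v) = (m + inv_seq k)%N.
Proof.
(* All inversions except those inside the middle block, with [l] standing for any of its
   rearrangements. *)
exists (inv_seq u + (inv_seq v + inv_cross l v) + inv_cross u (l ++ v))%N.
move=> k kl.
rewrite !inv_seq_cat (inv_cross_perm kl (perm_refl v)).
have kvlv : perm_eq (k ++ v) (l ++ v) by rewrite perm_cat2r.
rewrite (inv_cross_perm (perm_refl u) kvlv).
lia.
Qed.

(** The order of the quantifiers matters: one [c] serves every [k] with the given row contents,
    hence all monomials of a relation at once. *)
Lemma biweight_context u v (s l : seq 'I_r) : exists c : S, forall k,
  perm_eq (unzip1 k) s -> perm_eq (unzip2 k) l ->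
  biweight (u ++ k ++ v) = c * biweight k.
Proof.
have [m1 Hm1] := inv_seq_context (unzip1 u) (unzip1 v) s.
have [m2 Hm2] := inv_seq_context (unzip2 u) (unzip2 v) l.
exists (t ^+ m2 / t ^+ m1) => k /Hm1 k1 /Hm2 k2.
rewrite /biweight !(unzip1_cat, unzip2_cat) k1 k2 !exprD invrM ?unitrX //.
by rewrite [RHS]mulrACA [X in _ = _ * X]mulrC.
Qed.

End BiwordWeight.

(** * Two-sided ideals and monomial contexts in a monoid algebra *)

Section TwoSidedIdeal.
Variables (A : nzRingType) (G : A -> Prop).

Lemma two_sided_ideal0 : two_sided_ideal G 0.
Proof.
exists 0%N, (fun=> 0), (fun=> 0), (fun=> 0); split; first by case.
by rewrite big_ord0.
Qed.

Lemma two_sided_idealD x y :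
  two_sided_ideal G x -> two_sided_ideal G y -> two_sided_ideal G (x + y).
Proof.
move=> [m [a [g [b [Gg ->]]]]] [n [c [h [d [Gh ->]]]]].
pose glue (e : 'I_m -> A) (f : 'I_n -> A) i :=
  match split i with inl j => e j | inr j => f j end.
exists (m + n)%N, (glue a c), (glue g h), (glue b d); split.
  by move=> i; rewrite /glue; case: split.
rewrite big_split_ord /glue; congr (_ + _); apply: eq_bigr => i _.
  by rewrite (unsplitK (inl _ i)).
by rewrite (unsplitK (inr _ i)).
Qed.

Lemma two_sided_ideal_sum (I : Type) (s : seq I) (P : pred I) (F : I -> A) :
  (forall i, P i -> two_sided_ideal G (F i)) ->
  two_sided_ideal G (\sum_(i <- s | P i) F i).
Proof.
by move=> GF; apply: big_ind => //;
   [apply: two_sided_ideal0 | apply: two_sided_idealD].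
Qed.

Lemma two_sided_ideal_gen a g b : G g -> two_sided_ideal G (a * g * b).
Proof.
move=> Gg; exists 1%N, (fun=> a), (fun=> g), (fun=> b); split=> //.
by rewrite big_ord1.
Qed.

End TwoSidedIdeal.

Lemma malgUU_mul (K : monomType) (R : nzRingType) (c d : R) (u v : K) :
  << c *g u >> * << d *g v >> = << c * d *g mmul u v >> :> {malg R[K]}.
Proof. by rewrite malgM_def fgmulUU. Qed.

Lemma malgUZ (K : choiceType) (R : nzRingType) (c d : R) (u : K) :
  c *: << d *g u >> = << c * d *g u >> :> {malg R[K]}.
Proof. by apply/malgP => k; rewrite mcoeffZ !mcoeffU mulrnAr. Qed.

Lemma malgZAr (K : monomType) (R : comNzRingType) (c : R) (x y : {malg R[K]}) :
  x * (c *: y) = c *: (x * y).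
Proof.
rewrite [x]monalgE [y]monalgE scaler_sumr !mulr_suml scaler_sumr.
apply: eq_bigr => u _; rewrite !mulr_sumr scaler_sumr; apply: eq_bigr => v _.
by rewrite malgUZ !malgUU_mul malgUZ mulrCA.
Qed.

Section Sandwich.
Variables (K : monomType) (R : comNzRingType) (u v : K).

Definition sandwich (z : {malg R[K]}) : {malg R[K]} := << u >> * z * << v >>.

Lemma sandwich_is_additive : zmod_morphism sandwich.
Proof. by move=> x y; rewrite /sandwich mulrBr mulrBl. Qed.

HB.instance Definition _ :=
  GRing.isZmodMorphism.Build {malg R[K]} {malg R[K]} sandwich
    sandwich_is_additive.

Lemma sandwichB : {morph sandwich : x y / x - y}. Proof. exact: raddfB. Qed.
Lemma sandwichD : {morph sandwich : x y / x + y}. Proof. exact: raddfD. Qed.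

Lemma sandwichU c k : sandwich << c *g k >> = << c *g mmul (mmul u k) v >>.
Proof. by rewrite /sandwich !malgUU_mul mul1r mulr1. Qed.

End Sandwich.

(** Reduces arbitrary multipliers of a generator to monomial ones, the only ones on which the weight
    can be controlled. *)
Lemma malg_bimulE (K : monomType) (R : comNzRingType) (a g b : {malg R[K]}) :
  a * g * b = \sum_(u <- msupp a) \sum_(v <- msupp b)
                (a@_u * b@_v) *: sandwich u v g.
Proof.
have mul_sums (A : nzRingType) (I J : Type) (s : seq I) (s' : seq J)
    (F : I -> A) (F' : J -> A) h :
  (\sum_(i <- s) F i) * h * (\sum_(j <- s') F' j) =
  \sum_(i <- s) \sum_(j <- s') F i * h * F' j.
  by rewrite !mulr_suml; apply: eq_bigr => i _; rewrite mulr_sumr.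
rewrite {1}[a]monalgE {1}[b]monalgE [LHS]mul_sums.
apply: eq_bigr => u _; apply: eq_bigr => v _.
have scaleU (c : R) (k : K) : << c *g k >> = c *: << k >>.
  by rewrite malgUZ mulr1.
by rewrite (scaleU a@_u) (scaleU b@_v) malgZAr -!scalerAl scalerA mulrC.
Qed.

(** * The semilinear rescaling of monomials *)

Section Twist.
Variables (K : choiceType) (R S : comNzRingType) (f : {rmorphism R -> S}).
Variable w : K -> S.

Definition twist (z : {malg R[K]}) : {malg S[K]} :=
  \sum_(k <- msupp z) << f z@_k * w k *g k >>.

Lemma mcoeff_twist z k : (twist z)@_k = f z@_k * w k.
Proof.
rewrite /twist raddf_sum /=; have [kz|kz] := boolP (k \in msupp z).
  rewrite (bigD1_seq k) ?fset_uniq //= mcoeffUU big1 ?addr0 // => l lk.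
  by rewrite mcoeffU (negPf lk).
rewrite (mcoeff_outdom kz) rmorph0 mul0r big_seq big1 // => l lz.
by rewrite mcoeffU; case: eqVneq lz kz => [->->|].
Qed.

Lemma twist_is_additive : zmod_morphism twist.
Proof.
by move=> x y; apply/malgP => k;
   rewrite mcoeffB !mcoeff_twist mcoeffB rmorphB mulrBl.
Qed.

HB.instance Definition _ :=
  GRing.isZmodMorphism.Build {malg R[K]} {malg S[K]} twist twist_is_additive.

Lemma twistB : {morph twist : x y / x - y}. Proof. exact: raddfB. Qed.
Lemma twistD : {morph twist : x y / x + y}. Proof. exact: raddfD. Qed.

Lemma twistU c k : twist << c *g k >> = << f c * w k *g k >>.
Proof.
apply/malgP => l; rewrite mcoeff_twist !mcoeffU.
by case: eqVneq => [->|_]; rewrite ?mulr0n ?rmorph0 ?mul0r.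
Qed.

Lemma twistZ c z : twist (c *: z) = f c *: twist z.
Proof.
by apply/malgP => k; rewrite mcoeffZ !mcoeff_twist mcoeffZ rmorphM mulrA.
Qed.

End Twist.

(** Since [w] need not be multiplicative, [twist] need not be a ring morphism; it suffices that each
    generator in a monomial context goes to a multiple of a generator in the same context. *)
Lemma twist_two_sided_ideal (K : monomType) (R S : comNzRingType)
    (f : {rmorphism R -> S}) (w : K -> S)
    (G : {malg R[K]} -> Prop) (H : {malg S[K]} -> Prop) z :
  (forall g u v, G g -> exists c : S, exists2 h, H h &
     twist f w (sandwich u v g) = c *: sandwich u v h) ->
  two_sided_ideal G z -> two_sided_ideal H (twist f w z).
Proof.
move=> GH [n [a [g [b [Gg ->]]]]]; rewrite raddf_sum.
apply: two_sided_ideal_sum => i _.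
rewrite malg_bimulE raddf_sum; apply: two_sided_ideal_sum => u _.
rewrite raddf_sum; apply: two_sided_ideal_sum => v _ /=.
have [c [h Hh E]] := GH _ u v (Gg i).
rewrite twistZ E scalerA /sandwich !scalerAl; exact: two_sided_ideal_gen.
Qed.

(* The defining relations for an arbitrary invertible parameter; the parameter *)
(* 1 gives [bracket] and [qvar] gives [bracketq].                              *)
Section Relations.
Variables (r : nat) (R : comUnitRingType) (q : R).

Definition relation (x y a b : 'I_r) : {malg R[biword r]} :=
  << biw [:: x; y] [:: a; b] >> -
  (if a == b then << q *g biw [:: y; x] [:: a; a] >>
   else << biw [:: y; x] [:: b; a] >> + << q *g biw [:: y; x] [:: a; b] >>
        - << q^-1 *g biw [:: x; y] [:: b; a] >>).

Definition relations (g : {malg R[biword r]}) : Prop :=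
  exists x y a b : 'I_r, [/\ (y < x)%N, (b <= a)%N & g = relation x y a b].

Definition MacMahon : series r R := ssub (smul (Ferm r q) (Bos r q)) (sone r R).

Definition MacMahon_holds : Prop :=
  forall n, two_sided_ideal relations (hcomp n MacMahon).

End Relations.

(* Used instead of rewriting terms of [malg]: when an instantiated pattern is  *)
(* compared with another monomial, conversion unfolds finite maps.             *)
Lemma subr_congr (V : zmodType) (x x' y y' : V) :
  x = x' -> y = y' -> x - y = x' - y'.
Proof. by move=> -> ->. Qed.

Lemma addr_congr (V : zmodType) (x x' y y' : V) :
  x = x' -> y = y' -> x + y = x' + y'.
Proof. by move=> -> ->. Qed.

(** * Transport of the identity from parameter p to parameter [t * f p] *)

Section Transport.
Variables (r : nat) (R S : comUnitRingType) (f : {rmorphism R -> S}).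
Variables (p : R) (t : S).
Hypotheses (p_unit : p \is a GRing.unit) (t_unit : t \is a GRing.unit).

Let fp_unit : f p \is a GRing.unit. Proof. exact: rmorph_unit. Qed.

Lemma biweight_Ferm u : Ferm r (t * f p) u = f (Ferm r p u) * biweight t u.
Proof.
rewrite /Ferm rmorph_sum mulr_suml; apply: eq_bigr => J _.
rewrite rmorphM rmorphXn rmorphN1 -mulrA; congr (_ * _).
rewrite rmorph_sum mulr_suml; apply: eq_bigr => s _.
rewrite rmorphM rmorph_nat -!mulrA; case: eqP => [->|_];
  last by rewrite !(mul0r, mulr0).
rewrite mulr1 mul1r winvE /biweight.
rewrite unzip1_zip ?size_map // unzip2_zip ?size_map //.
(* The bottom row is increasing, so only the inversions of the top row enter the weight. *)
rewrite inv_seq_enum expr0 rmorphV ?unitrX ?unitrN // rmorphXn rmorphN.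
rewrite mul1r [(- (t * _)) ^+ _]exprNn [(- f p) ^+ _]exprNn !invr_signM.
by rewrite exprMn invrM ?unitrX // mulrA.
Qed.

Lemma biweight_Bos u : Bos r (t * f p) u = f (Bos r p u) * biweight t u.
Proof.
rewrite /Bos rmorph_sum mulr_suml; apply: eq_bigr => -[w _] _ /=.
rewrite rmorphM rmorph_nat -!mulrA; case: eqP => [->|_];
  last by rewrite !(mul0r, mulr0).
rewrite mulr1 mul1r winvE /biweight.
rewrite unzip1_zip ?size_sort // unzip2_zip ?size_sort //.
by rewrite inv_seq_sort expr0 divr1 rmorphXn exprMn mulrC.
Qed.

(** A permutation supported on [J] maps [J] onto itself, so both rows list [J] without
    repetition. *)
Lemma Ferm_circuit (q : R) (u : seq (biletter r)) :
  ~~ circuit u -> Ferm r q (FMonom u) = 0.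
Proof.
move=> uN; rewrite /Ferm big1 // => J _; rewrite big1 ?mulr0 // => s Js.
case: eqP => [[uE]|_]; last by rewrite mulr0.
case/negP: uN; rewrite uE /circuit.
rewrite unzip1_zip ?size_map // unzip2_zip ?size_map //.
apply: uniq_perm; rewrite ?map_inj_uniq ?enum_uniq //; first exact: perm_inj.
move=> i; rewrite mem_enum; apply/mapP/idP => [[j jJ ->]|iJ].
  by rewrite (perm_closed _ Js) -mem_enum.
by exists (s^-1%g i); rewrite ?permKV // mem_enum -(perm_closed _ Js) permKV.
Qed.

Lemma Bos_circuit (q : R) (u : seq (biletter r)) :
  ~~ circuit u -> Bos r q (FMonom u) = 0.
Proof.
move=> uN; rewrite /Bos big1 // => -[w _] _ /=.
case: eqP => [[uE]|_]; last by rewrite mulr0.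
case/negP: uN; rewrite uE /circuit.
rewrite unzip1_zip ?size_sort // unzip2_zip ?size_sort //.
by rewrite perm_sort.
Qed.

(** Compared factorization by factorization: either both factors are circuits and their weights
    multiply, or both sides are zero. *)
Lemma biweight_MacMahon (u : biword r) :
  MacMahon (t * f p) u = f (MacMahon p u) * biweight t u.
Proof.
rewrite /MacMahon /ssub rmorphB mulrBl; congr (_ - _); last first.
  by rewrite /sone rmorph_nat; case: eqP => [->|_];
     rewrite ?mul0r //= biweight_nil mulr1.
rewrite /smul rmorph_sum mulr_suml; apply: eq_bigr => i _.
rewrite biweight_Ferm biweight_Bos rmorphM mulrACA /=.
have [c1|/(Ferm_circuit p) ->] := boolP (circuit (take i u)); last first.
  by rewrite rmorph0 !mul0r.
have [c2|/(Bos_circuit p) ->] := boolP (circuit (drop i u)); last first.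
  by rewrite rmorph0 mulr0 !mul0r.
by rewrite -(biweight_circuit_cat t_unit c1 c2) cat_take_drop.
Qed.

Lemma twist_hcomp n (E : series r R) (w : biword r -> S) :
  twist f w (hcomp n E) = hcomp n (fun u => f (E u) * w u).
Proof.
by rewrite /hcomp raddf_sum; apply: eq_bigr => s _; rewrite /= twistU.
Qed.

Lemma twist_relation (g : {malg R[biword r]}) (u v : biword r) :
  relations p g -> exists c : S, exists2 h, relations (t * f p) h &
    twist f (fun k : biword r => biweight t k) (sandwich u v g)
    = c *: sandwich u v h.
Proof.
move=> [x [y [a [b [yx ba ->]]]]].
have [c Hc] := biweight_context t_unit u v [:: x; y] [:: a; b].
have xyx : perm_eq [:: y; x] [:: x; y].
  by rewrite (perm_catC [:: y] [:: x]).
have bab : perm_eq [:: b; a] [:: a; b].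
  by rewrite (perm_catC [:: b] [:: a]).
(* The leading monomial has one inversion on top. If a = b it has none below, so its weight t^-1 is
   factored out; if b < a its weight is t / t = 1. *)
pose e := c * if a == b then t^-1 else 1.
exists e; exists (relation (t * f p) x y a b); first by exists x, y, a, b.
(* Monomialwise check: once the context factor [c] is removed, the coefficient [d] must become [d']
   up to the scalar common to the whole relation. *)
have TL (d : R) (d' : S) (k : biword r) :
    perm_eq (unzip1 k) [:: x; y] -> perm_eq (unzip2 k) [:: a; b] ->
    f d * biweight t k = (if a == b then t^-1 else 1) * d' ->
  twist f (fun k : biword r => biweight t k) (sandwich u v << d *g k >>) =
  e *: sandwich u v << d' *g k >>.
  move=> k1 k2 dd'; rewrite sandwichU twistU sandwichU malgUZ.
  congr << _ *g _ >>.
  rewrite !fmM -catA (Hc k k1 k2) mulrCA dd' /e mulrA.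
  by case: (a == b); rewrite ?mulr1.
have xNy : (x < y)%N = false by rewrite ltnNge ltnW.
have aNb : (a < b)%N = false by rewrite ltnNge ba.
rewrite /relation; case: (altP eqP) => [ab|ab].
  rewrite !sandwichB twistB scalerBr.
  apply: subr_congr; apply: TL;
    rewrite ?ab ?eqxx ?biweight_pair ?ltnn ?yx ?xNy //.
  - by rewrite rmorph1 expr0 expr1 mulr1 mul1r mul1r.
  - by rewrite expr0 divr1 mulr1 mulKr.
have bLa : (b < a)%N by rewrite ltn_neqAle eq_sym ab ba.
rewrite !(sandwichB, sandwichD) !(twistB, twistD) !(scalerBr, scalerDr).
apply: subr_congr; last apply: subr_congr; last 1 first.
- apply: TL => //; rewrite (negPf ab) mul1r biweight_pair yx aNb expr0 expr1.
  by rewrite rmorphV // invrM // mul1r.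
- apply: TL => //; rewrite (negPf ab) mul1r biweight_pair yx bLa expr1.
  by rewrite rmorph1 mul1r mulrV.
apply: addr_congr; apply: TL => //; rewrite (negPf ab) mul1r biweight_pair xNy.
  by rewrite aNb rmorph1 expr0 divr1 mulr1.
by rewrite bLa expr0 expr1 divr1 mulrC.
Qed.

Lemma MacMahon_transport :
  MacMahon_holds r p -> MacMahon_holds r (t * f p).
Proof.
move=> Hp n.
have -> : hcomp n (MacMahon (t * f p)) =
    twist f (fun k : biword r => biweight t k) (hcomp n (MacMahon p)).
  rewrite twist_hcomp; apply: eq_bigr => s _.
  by rewrite biweight_MacMahon.
by apply: twist_two_sided_ideal (Hp n) => g u v; apply: twist_relation.
Qed.

End Transport.

(** * Evaluation of Laurent polynomials at q = 1 *)

Section EvaluationAtOne.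

Local Notation "x %:F" := (@FracField.tofrac _ x) : ring_scope.

Lemma tofracXn_neq0 n :
  ('X : {poly int})%:F ^+ n != 0 :> {fraction {poly int}}.
Proof. by rewrite expf_neq0 // tofracX_neq0. Qed.

Lemma laurentP (x : laurent) :
  exists pn : {poly int} * nat, val x = pn.1%:F / ('X%:F) ^+ pn.2.
Proof. by have /asboolP[p [n xE]] := valP x; exists (p, n). Qed.

(** Evaluates the numerator of a chosen representation; the denominator is a power of q, worth 1 at
    q = 1. *)
Definition laurent_eval1 (x : laurent) : int := (sval (cid (laurentP x))).1.[1].

(** Independence of the choice: cross-multiplying two representations equates their numerators up to
    powers of ['X], which become 1 at 1. *)
Lemma laurent_eval1E (x : laurent) (p : {poly int}) (n : nat) :
  val x = p%:F / ('X%:F) ^+ n -> laurent_eval1 x = p.[1].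
Proof.
rewrite /laurent_eval1; case: cid => -[s m] /= ->.
move/eqP; rewrite eqr_div ?tofracXn_neq0 // -!tofracXn -!tofracM tofrac_eq.
move=> /eqP /(congr1 (horner^~ 1)).
by rewrite !hornerM !hornerXn !expr1n !mulr1.
Qed.

Lemma laurent_eval1_is_additive : zmod_morphism laurent_eval1.
Proof.
move=> x y; have [[p m] /= xE] := laurentP x; have [[s n] /= yE] := laurentP y.
rewrite (laurent_eval1E xE) (laurent_eval1E yE).
rewrite (@laurent_eval1E _ (p * 'X^n - s * 'X^m) (m + n)).
  by rewrite !(hornerE, hornerXn) !expr1n !mulr1.
rewrite rmorphB /= xE yE tofracB !tofracM !tofracXn exprD -mulNr.
by rewrite addf_div ?tofracXn_neq0 // mulNr.
Qed.

Lemma laurent_eval1_is_multiplicative : monoid_morphism laurent_eval1.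
Proof.
split=> [|x y].
  rewrite (@laurent_eval1E _ 1 0) ?hornerC //.
  by rewrite rmorph1 tofrac1 expr0 divr1.
have [[p m] /= xE] := laurentP x; have [[s n] /= yE] := laurentP y.
rewrite (laurent_eval1E xE) (laurent_eval1E yE) -hornerM.
apply: (@laurent_eval1E _ _ (m + n)).
by rewrite rmorphM /= xE yE tofracM exprD mulf_div.
Qed.

HB.instance Definition _ :=
  GRing.isZmodMorphism.Build laurent int laurent_eval1
    laurent_eval1_is_additive.

HB.instance Definition _ :=
  GRing.isMonoidMorphism.Build laurent int laurent_eval1
    laurent_eval1_is_multiplicative.

Lemma laurent_eval1_qvar : laurent_eval1 qvar = 1.
Proof. by rewrite (@laurent_eval1E _ 'X 0) ?hornerX //= expr0 divr1. Qed.

End EvaluationAtOne.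

(** * The equivalence *)

Lemma two_sided_ideal_ext (A : nzRingType) (G H : A -> Prop) z :
  (forall g, G g <-> H g) -> two_sided_ideal G z <-> two_sided_ideal H z.
Proof.
by move=> GH; split=> -[n [a [g [b [Gg ->]]]]]; exists n, a, g, b; split=> // i;
   apply/GH.
Qed.

Lemma relations1E r g : relations (1 : int) g <-> gens (r := r) g.
Proof.
by split=> -[x [y [a [b [yx ba ->]]]]]; exists x, y, a, b; split;
   rewrite // /relation /bracket invr1.
Qed.

Theorem corollary4 (r : nat) (hr : (2 <= r)%N) :
  eqmodIq (smul (Ferm r qvar) (Bos r qvar)) (sone r laurent) <->
  eqmodI (smul (Ferm r (1 : int)) (Bos r (1 : int))) (sone r int).
Proof.
have -> : eqmodI (smul (Ferm r (1 : int)) (Bos r (1 : int))) (sone r int)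
    <-> MacMahon_holds r (1 : int).
  by split=> H n; apply/(two_sided_ideal_ext _ (@relations1E r)); apply: H.
split=> [Hq|H1].
  (* [Hq] is [MacMahon_holds r qvar] by conversion; with t = 1 all weights are 1 and only the
     evaluation acts. *)
  have := MacMahon_transport laurent_eval1 qvar_unit (unitr1 int) Hq.
  by rewrite /= laurent_eval1_qvar mulr1.
(* Here the integers embed in the Laurent polynomials and the parameter q comes entirely from the
   weight. *)
have := MacMahon_transport intr (unitr1 int) qvar_unit H1.
by rewrite rmorph1 mulr1.
Qed.
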